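(* Let $x^\dagger\in\mathcal X$ and let $y=Kx^\dagger$ be the corresponding (exact) right-hand side. Assume that the restriction $K_n|_{\mathcal E_n}$ of $K_n$ to $\mathcal E_n$ is injective, and let $\mu_n$ be the smallest (positive) singular value of $K_n$. Then the Method III approximation $x_n^{III}$ computed from $y$ satisfies $$x_n^{III}-x^\dagger=(I-P_{\mathcal E_n})(x_n^\circ-x^\dagger)+d_n,$$ where $$\|d_n\|_{\mathcal X}\le\frac1{\mu_n}\Bigl(\|(K-K_n)(x_n^\circ-x^\dagger)\|_{\mathcal Y}+\|y_n^\circ-Kx_n^\circ\|_{\mathcal Y}\Bigr).$$
   Context: Setting: $\mathcal X,\mathcal Y$ are (real) Hilbert spaces, and $K:\mathcal X\to\mathcal Y$ is a bounded linear operator with non-closed range. Training pairs $(x_k,y_k)\in\mathcal X\times\mathcal Y$, $k=1,2,\dots$, are given with $\|y_k-Kx_k\|_{\mathcal Y}\le\delta$ for all $k$, for some noise level $\delta>0$. Neither the $x_k$ nor the $y_k$ are required to be linearly independent. Fix $n\in\mathbb N$. Sample means: $x_n^\circ=\frac1n\sum_{k=1}^n x_k$ and $y_n^\circ=\frac1n\sum_{k=1}^n y_k$. ''Matrices'' with columns in a Hilbert space: for $v_1,\dots,v_m$ in a Hilbert space $H$, $[v_1,\dots,v_m]$ denotes the linear map $\mathbb R^m\to H$, $\xi\mapsto\sum_{k=1}^m\xi_kv_k$. A star denotes the adjoint, and $A^\dagger$ is the Moore-Penrose generalized inverse of $A$ (all operators to which it is applied have finite rank). Singular value decomposition of the centered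 images: $[x_1-x_n^\circ,\dots,x_n-x_n^\circ]=U_n\Lambda\Xi^*$, where $p'$ is the rank of the left-hand side, $\Lambda\in\mathbb R^{p'\times p'}$ is diagonal with the positive singular values on its diagonal, $\Xi\in\mathbb R^{n\times p'}$ has orthonormal columns, and $U_n=[u_1,\dots,u_{p'}]:\mathbb R^{p'}\to\mathcal X$ has orthonormal columns $u_k\in\mathcal X$. It is understood that $p'\ge1$, so that $\mu_n$ exists. Space $\mathcal E_n$: $\mathcal E_n=\operatorname{span}\{u_1,\dots,u_{p'}\}=\operatorname{span}\{x_1-x_n^\circ,\dots,x_n-x_n^\circ\}\subset\mathcal X$, equipped with the (Cameron-Martin) norm $\|u\|_{\mathcal E_n}=\sqrt n\,\|\Lambda^{-1}U_n^*u\|_2$. $P_{\mathcal E_n}$ is the orthogonal projector of $\mathcal X$ onto $\mathcal E_n$, with respect to the inner product of $\mathcal X$. Operators: $Z_n=[y_1-y_n^\circ,\dots,y_n-y_n^\circ]\,\Xi\Lambda^{-1}:\mathbb R^{p'}\to\mathcal Y$, $K_n=Z_nU_n^*:\mathcal X\to\mathcal Y$, and $L_n=[y_1-y_n^\circ,\dots,y_n-y_n^\circ]\,\Xi:\mathbb R^{p'}\to\mathcal Y$. The singular values of $K_n$ are understood as those of $K_n:\mathcal X\to\mathcal Y$ with the original Hilbert space norms, and only positive singular values are counted. Method III: let $\mathcal Y_n=\operatorname{span}\{y_1-y_n^\circ,\dots,y_n-y_n^\circ\}$ with orthogonal projector $P_{\mathcal Y_n}$ in $\mathcal Y$. For given data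 $y\in\mathcal Y$, $x_n^{III}=x_n^\circ+u$, where $u\in\mathcal E_n$ is the element of minimal $\mathcal E_n$-norm among the minimizers over $\mathcal E_n$ of $\|P_{\mathcal Y_n}K_nu-P_{\mathcal Y_n}(y-y_n^\circ)\|_{\mathcal Y}$. Explicitly, $x_n^{III}=x_n^\circ+U_n\Lambda L_n^\dagger(y-y_n^\circ)$. *)

(* Defs.v *)
From HB Require Import structures.
From mathcomp Require Import all_boot all_order all_algebra.
From mathcomp Require Import all_classical all_reals all_analysis.

Set Implicit Arguments.
Unset Strict Implicit.
Unset Printing Implicit Defensive.

Import Order.TTheory GRing.Theory Num.Theory.
Import numFieldNormedType.Exports.

Local Open Scope classical_set_scope.
Local Open Scope ring_scope.

HB.mixin Record hasInner (R : numDomainType) E of GRing.Lmodule R E := {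
  inner : {dot E for @idfun R}
}.

#[short(type="innerProductType")]
HB.structure Definition InnerProduct (R : numDomainType) :=
  {E of GRing.Lmodule R E & hasInner R E}.

HB.mixin Record isHilbert (R : realType) E
    of CompleteNormedModule R E & hasInner R E := {
  sqr_normE : forall v : E, `|v| ^+ 2 = inner v v
}.

#[short(type="hilbertType")]
HB.structure Definition Hilbert (R : realType) :=
  {E of CompleteNormedModule R E & InnerProduct R E & isHilbert R E}.

(* The norm `|_| that the library puts on matrices is the maximum norm; the    *)
(* Euclidean norm ||_||_2 of a column is inorm, for the inner product below.   *)
Definition inorm (R : realType) (E : innerProductType R) (v : E) : R :=
  Num.sqrt (inner v v).

Definition cv_inner (R : realType) (m : nat) (xi eta : 'cV[R]_m) : R :=
  \sum_(i < m) xi i 0 * eta i 0.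

Section CvInner.
Context {R : realType} {m : nat}.

Let cv_inner_bilinear :
  bilinear_for ( *%R : GRing.Scale.law R R) ( *%R : GRing.Scale.law R R)
    (@cv_inner R m).
Proof.
split=> [v a u u'|u a v v']; rewrite /cv_inner/= mulr_sumr -big_split/=;
  apply: eq_bigr => i _; rewrite !mxE.
- by rewrite mulrDl mulrA.
- by rewrite mulrDr mulrCA.
Qed.

Let cv_inner_sym (u v : 'cV[R]_m) :
  cv_inner u v = (-1) ^+ false * idfun (cv_inner v u).
Proof. by rewrite mul1r/=; apply: eq_bigr => i _; rewrite mulrC. Qed.

Let cv_inner_gt0 (u : 'cV[R]_m) : u != 0 -> 0 < cv_inner u u.
Proof.
move=> u0; rewrite lt_def; apply/andP; split; last first.
  by apply: sumr_ge0 => i _; rewrite -expr2 sqr_ge0.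
apply: contra u0 => /eqP/psumr_eq0P h; apply/eqP/colP => i; rewrite mxE.
by apply/eqP; rewrite -[_ == 0]orbb -mulf_eq0 h// => j _; rewrite -expr2 sqr_ge0.
Qed.

HB.instance Definition _ := isBilinear.Build R 'cV[R]_m 'cV[R]_m R
  *%R (@idfun R \; *%R) (@cv_inner R m)
  (fun v => zmod_morphism_linear (cv_inner_bilinear.1 v))
  (fun u => zmod_morphism_linear (cv_inner_bilinear.2 u))
  (fun v => scalable_linear (cv_inner_bilinear.1 v))
  (fun u => scalable_linear (cv_inner_bilinear.2 u)).
HB.instance Definition _ := isHermitianSesquilinear.Build R 'cV[R]_m
  false (@idfun R) (@cv_inner R m) cv_inner_sym.
HB.instance Definition _ := isDotProduct.Build R 'cV[R]_m
  (@cv_inner R m) cv_inner_gt0.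
HB.instance Definition _ := hasInner.Build R 'cV[R]_m (@cv_inner R m).

End CvInner.

(* [adjoint A w] is the v with <A e, w> = <e, v> for all e (necessarily        *)
(* unique); the value 0 is junk, taken only where there is no such v.          *)
Definition adjoint (R : realType) (E F : innerProductType R) (A : E -> F)
    (w : F) : E :=
  xget 0 [set v | forall e, inner (A e) w = inner e v].

(* [orth_proj V v] is the point of the subspace V with v - orth_proj V v       *)
(* orthogonal to V; 0 is junk, taken only where there is no such point.        *)
Definition orth_proj (R : realType) (E : innerProductType R) (V : set E)
    (v : E) : E :=
  xget 0 [set w | V w /\ forall z, V z -> inner (v - w) z = 0].

Definition singular_value (R : realType) (E F : innerProductType R)
    (A : E -> F) (s : R) : Prop :=
  0 < s /\ exists2 v : E, v != 0 & adjoint A (A v) = s ^+ 2 *: v.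

Definition smallest_singular_value (R : realType) (E F : innerProductType R)
    (A : E -> F) (s : R) : Prop :=
  singular_value A s /\ forall t, singular_value A t -> s <= t.

Definition argmin (R : realType) (T : Type) (f : T -> R) (A : set T) : set T :=
  [set u | A u /\ forall w, A w -> f u <= f w].

(* The linear map [v_1, ..., v_m] : R^m -> H. *)
Definition cols (R : realType) (H : lmodType R) (m : nat) (v : 'I_m -> H)
    (xi : 'cV[R]_m) : H :=
  \sum_(k < m) xi k 0 *: v k.

Definition spanned (R : realType) (H : lmodType R) (m : nat) (v : 'I_m -> H) :
    set H :=
  range (cols v).

Definition orthonormal_family (R : realType) (H : innerProductType R) (m : nat)
    (v : 'I_m -> H) : Prop :=
  forall i j, inner (v i) (v j) = (i == j)%:R.

(* Sequences are indexed from 0: the first n vectors are v 0, ..., v n.-1.     *)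
Definition sample_mean (R : realType) (H : lmodType R) (n : nat)
    (v : nat -> H) : H :=
  n%:R^-1 *: \sum_(k < n) v k.

Definition centered (R : realType) (H : lmodType R) (n : nat) (v : nat -> H)
    (k : 'I_n) : H :=
  v k - sample_mean n v.

(* A = U Lam Xi^* with U = [u_1, ..., u_p] and Lam = diag_mx lam. It follows   *)
(* that p is the rank of A and that the lam 0 k are its positive singular      *)
(* values.                                                                     *)
Definition is_svd (R : realType) (H : innerProductType R) (n p : nat)
    (A : 'cV[R]_n -> H) (u : 'I_p -> H) (lam : 'rV[R]_p) (Xi : 'M[R]_(n, p)) :
    Prop :=
  [/\ orthonormal_family u,
      Xi^T *m Xi = 1%:M,
      forall k, 0 < lam 0 k
    & forall xi, A xi = cols u (diag_mx lam *m (Xi^T *m xi))].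

(* In what follows u, lam and Xi are meant to satisfy                          *)
(* is_svd (cols (centered x)) u lam Xi, so that E_n = spanned u.               *)

Definition En_norm (R : realType) (X : innerProductType R) (n p : nat)
    (u : 'I_p -> X) (lam : 'rV[R]_p) (v : X) : R :=
  Num.sqrt n%:R * inorm (invmx (diag_mx lam) *m adjoint (cols u) v).

Definition Zn (R : realType) (Y : lmodType R) (n p : nat) (y : nat -> Y)
    (lam : 'rV[R]_p) (Xi : 'M[R]_(n, p)) (xi : 'cV[R]_p) : Y :=
  cols (@centered R Y n y) (Xi *m (invmx (diag_mx lam) *m xi)).

Definition Kn (R : realType) (X : innerProductType R) (Y : lmodType R)
    (n p : nat) (y : nat -> Y) (u : 'I_p -> X) (lam : 'rV[R]_p)
    (Xi : 'M[R]_(n, p)) (v : X) : Y :=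
  Zn y lam Xi (adjoint (cols u) v).

Definition methodIII (R : realType) (X Y : hilbertType R) (n p : nat)
    (x : nat -> X) (y : nat -> Y) (u : 'I_p -> X) (lam : 'rV[R]_p)
    (Xi : 'M[R]_(n, p)) (y' : Y) : X :=
  let P := orth_proj (spanned (@centered R Y n y)) in
  let residual v := `|P (Kn y u lam Xi v) - P (y' - sample_mean n y)| in
  sample_mean n x +
  xget 0 (argmin (En_norm n u lam) (argmin residual (spanned u))).

(* Main.v *)
Require Import Defs.
From HB Require Import structures.
From mathcomp Require Import all_boot all_order all_algebra.
From mathcomp Require Import all_classical all_reals all_analysis.
From mathcomp Require Import ring lra.

Set Implicit Arguments.
Unset Strict Implicit.
Unset Printing Implicit Defensive.

Import Order.TTheory GRing.Theory Num.Theory.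
Import numFieldNormedType.Exports.

Local Open Scope classical_set_scope.
Local Open Scope ring_scope.

(** The idea is that Method III is a least-squares problem whose solution
differs from the best conceivable one by an element of E_n, and that K_n is
bounded below by mu on E_n.

Write A = K_n, e = xo - xdag, b = K xdag - yo, and P for the orthogonal
projector onto E_n. The range of A lies in Y_n, so projecting the data onto Y_n
changes neither A nor the normal equations; as A is injective on E_n, the
minimizer w of the residual is unique, the choice of least E_n-norm is vacuous,
and A w - b is orthogonal to A E_n ([methodIII_normal_equations]). Put
d = w + P e, an element of E_n. Then xo + w - xdag = (e - P e) + d. Since A
factors through the adjoint of U_n it does not see e - P e ([Kn_orth_proj]), so
A d = A w + A e. Hence A d - (b + A e) = A w - b is orthogonal to A d, and A d is
no longer than b + A e = -(K e - A e) - (yo - K xo).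

It remains to show mu |d| <= |A d| ([smallest_singular_value_le]). Through the
orthonormal family u, A becomes a map on R^p; its Rayleigh quotient attains a
minimum c on the Euclidean unit sphere ([rayleigh_min]), the minimizer is an
eigenvector of the normal operator ([min_eigen]), and c > 0 by injectivity. So
sqrt c is a singular value of A, whence mu^2 <= c.

Orthogonal projections onto the span of a family that may be linearly dependent
come from the solvability of the normal equations ([normal_equations]). *)

(** * Inner products *)

Lemma innerC (R : realType) (E : innerProductType R) (a b : E) :
  inner a b = inner b a.
Proof. by rewrite hermC expr0 mul1r. Qed.

Lemma innerDl (R : realType) (E : innerProductType R) (a b c : E) :
  inner (a + b) c = inner a c + inner b c.
Proof. by rewrite linearDl. Qed.

Lemma innerDr (R : realType) (E : innerProductType R) (a b c : E) :
  inner a (b + c) = inner a b + inner a c.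
Proof. by rewrite !(innerC a) innerDl. Qed.

Lemma innerZl (R : realType) (E : innerProductType R) k (a b : E) :
  inner (k *: a) b = k * inner a b.
Proof. by rewrite linearZl_LR. Qed.

Lemma innerZr (R : realType) (E : innerProductType R) k (a b : E) :
  inner a (k *: b) = k * inner a b.
Proof. by rewrite !(innerC a) innerZl. Qed.

Lemma innerBl (R : realType) (E : innerProductType R) (a b c : E) :
  inner (a - b) c = inner a c - inner b c.
Proof. by rewrite -scaleN1r innerDl innerZl mulN1r. Qed.

Lemma innerBr (R : realType) (E : innerProductType R) (a b c : E) :
  inner a (b - c) = inner a b - inner a c.
Proof. by rewrite !(innerC a) innerBl. Qed.

Lemma inner_suml (R : realType) (E : innerProductType R) (I : finType)
    (f : I -> E) (b : E) :
  inner (\sum_i f i) b = \sum_i inner (f i) b.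
Proof. exact: (linear_sumlz inner). Qed.

Lemma inner0l (R : realType) (E : innerProductType R) (b : E) : inner 0 b = 0.
Proof. by rewrite -(scale0r 0) innerZl mul0r. Qed.

Lemma inner_gt0 (R : realType) (E : innerProductType R) (a : E) :
  a != 0 -> 0 < inner a a.
Proof. exact: neq0_dnorm_gt0. Qed.

Lemma inner_ge0 (R : realType) (E : innerProductType R) (a : E) :
  0 <= inner a a.
Proof.
by have [->|/inner_gt0/ltW//] := eqVneq a 0; rewrite inner0l.
Qed.

Lemma inner_eq0 (R : realType) (E : innerProductType R) (a : E) :
  inner a a = 0 -> a = 0.
Proof.
by move=> aa; apply/eqP; apply: contraPT isT => /inner_gt0; rewrite aa ltxx.
Qed.

Lemma pythagoras (R : realType) (E : innerProductType R) (a b : E) :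
  inner a b = 0 -> inner (a + b) (a + b) = inner a a + inner b b.
Proof.
by move=> ab; rewrite innerDl !innerDr (innerC b a) ab addr0 add0r.
Qed.

(** * Maps given by their columns, and their adjoints *)

Lemma cols_linear (R : realType) (H : lmodType R) (m : nat) (v : 'I_m -> H) :
  linear (cols v).
Proof.
move=> k a b; rewrite /cols scaler_sumr -big_split; apply: eq_bigr => i _ /=.
by rewrite !mxE scalerDl scalerA.
Qed.

HB.instance Definition _ (R : realType) (H : lmodType R) (m : nat)
    (v : 'I_m -> H) :=
  GRing.isLinear.Build R 'cV[R]_m H *:%R (cols v) (cols_linear v).

Lemma spanned_cols (R : realType) (H : lmodType R) (m : nat) (v : 'I_m -> H) xi :
  spanned v (cols v xi).
Proof. by exists xi. Qed.

Lemma spannedD (R : realType) (H : lmodType R) (m : nat) (v : 'I_m -> H) a b :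
  spanned v a -> spanned v b -> spanned v (a + b).
Proof.
by move=> [xi _ <-] [eta _ <-]; exists (xi + eta) => //; rewrite linearD.
Qed.

Lemma spannedB (R : realType) (H : lmodType R) (m : nat) (v : 'I_m -> H) a b :
  spanned v a -> spanned v b -> spanned v (a - b).
Proof.
by move=> [xi _ <-] [eta _ <-]; exists (xi - eta) => //; rewrite linearB.
Qed.

Lemma adjoint_eq (R : realType) (E F : innerProductType R) (A : E -> F) w v :
  (forall e, inner (A e) w = inner e v) -> adjoint A w = v.
Proof.
move=> Av; apply: xget_unique => // v' Av'.
by apply/subr0_eq/inner_eq0; rewrite innerBr -Av -Av' subrr.
Qed.

Lemma inner_cols (R : realType) (H : innerProductType R) (m : nat)
    (v : 'I_m -> H) xi w :
  inner (cols v xi) w = inner xi (\col_k inner (v k) w).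
Proof.
by rewrite inner_suml; apply: eq_bigr => i _; rewrite innerZl mxE.
Qed.

Lemma adjoint_cols (R : realType) (H : innerProductType R) (m : nat)
    (v : 'I_m -> H) w :
  adjoint (cols v) w = \col_k inner (v k) w.
Proof. by apply: adjoint_eq => xi; exact: inner_cols. Qed.

Lemma adjoint_colsP (R : realType) (H : innerProductType R) (m : nat)
    (v : 'I_m -> H) xi w :
  inner (cols v xi) w = inner xi (adjoint (cols v) w).
Proof. by rewrite adjoint_cols inner_cols. Qed.

Lemma adjoint_colsD (R : realType) (H : innerProductType R) (m : nat)
    (v : 'I_m -> H) a b :
  adjoint (cols v) (a + b) = adjoint (cols v) a + adjoint (cols v) b.
Proof.
by rewrite !adjoint_cols; apply/colP => k; rewrite !mxE innerDr.
Qed.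

Lemma adjoint_cols_orthonormal (R : realType) (H : innerProductType R)
    (m : nat) (u : 'I_m -> H) xi :
  orthonormal_family u -> adjoint (cols u) (cols u xi) = xi.
Proof.
move=> ou; rewrite adjoint_cols; apply/colP => k; rewrite mxE innerC inner_suml.
rewrite (bigD1 k)//= innerZl ou eqxx mulr1 big1 ?addr0// => i ik.
by rewrite innerZl ou (negbTE ik) mulr0.
Qed.

(** * Orthogonal projection onto the span of a finite family *)

(** Let G be the Gram matrix and c the vector of the <v_k, b>. Any eta with
G eta = 0 has [cols v eta] = 0, as its squared norm is eta^T G eta, hence
c^T eta = <[cols v eta], b> = 0: so c is orthogonal to the kernel of the
symmetric matrix G, i.e. in its range. This covers dependent families too. *)
Lemma normal_equations (R : realType) (H : innerProductType R) (m : nat)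
    (v : 'I_m -> H) (b : H) :
  exists xi, forall eta, inner (b - cols v xi) (cols v eta) = 0.
Proof.
pose G : 'M[R]_m := \matrix_(i, j) inner (v i) (v j).
have GE eta : G *m eta = \col_k inner (v k) (cols v eta).
  apply/colP => k; rewrite !mxE innerC inner_suml; apply: eq_bigr => i _.
  by rewrite innerZl mxE mulrC innerC.
pose c := \col_k inner (v k) b.
have Gsym : G^T = G by apply/matrixP => i j; rewrite !mxE innerC.
(* the columns of the cokernel matrix of G span the kernel of G *)
have cG : (c^T <= G)%MS.
  rewrite submxE; apply/eqP/rowP => j.
  pose eta := col j (cokermx G).
  have Geta : G *m eta = 0 by rewrite /eta colE mulmxA mulmx_coker mul0mx.
  have veta : cols v eta = 0.
    apply: inner_eq0; rewrite inner_cols -GE Geta.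
    by rewrite innerC inner0l.
  have := inner_cols v eta b; rewrite veta inner0l => /esym h.
  rewrite [RHS]mxE -[RHS]h !mxE; apply: eq_bigr => i _.
  by rewrite !mxE mulrC.
have [xi xiE] := submxP cG.
exists xi^T => eta; rewrite innerC innerBr !inner_cols -GE.
by rewrite -[G]Gsym -trmx_mul -xiE trmxK subrr.
Qed.

Lemma orth_projP (R : realType) (H : innerProductType R) (m : nat)
    (v : 'I_m -> H) (b : H) :
  spanned v (orth_proj (spanned v) b) /\
  forall z, spanned v z -> inner (b - orth_proj (spanned v) b) z = 0.
Proof.
have [xi xiP] := normal_equations v b.
rewrite /orth_proj; apply: (@xgetPex _ 0 [set w | spanned v w /\ _]).
by exists (cols v xi); split => [|_ [eta _ <-]]; [exact: spanned_cols|].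
Qed.

Lemma orth_proj_id (R : realType) (H : innerProductType R) (m : nat)
    (v : 'I_m -> H) (z : H) :
  spanned v z -> orth_proj (spanned v) z = z.
Proof.
have [sP oP] := orth_projP v z => sz.
by apply/esym/subr0_eq/inner_eq0/oP; exact: spannedB.
Qed.

(** * Smallest singular values as lower bounds *)

(** At t = - b / (h + 1) the polynomial 2 b t + h t^2 takes the value
- b^2 (h + 2) / (h + 1)^2; the shift of h by 1 covers the case h = 0. *)
Lemma nonneg_quadratic_linear_term (R : realType) (b h : R) :
  0 <= h -> (forall t, 0 <= t * b *+ 2 + t ^+ 2 * h) -> b = 0.
Proof.
move=> h0 /(_ (- b / (h + 1))).
have h1 : h + 1 != 0 by lra.
have -> : - b / (h + 1) * b *+ 2 + (- b / (h + 1)) ^+ 2 * h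
    = - ((b / (h + 1)) ^+ 2 * (h + 2)) by field.
rewrite oppr_ge0 pmulr_lle0; last by lra.
move=> le0; apply/eqP.
have : (b / (h + 1)) ^+ 2 == 0 by rewrite eq_le le0 sqr_ge0.
by rewrite sqrf_eq0 mulf_eq0 invr_eq0 (negbTE h1) orbF.
Qed.

(** A continuous function attains its minimum on the compact unit sphere. The
sphere is taken in the space of rows, with the entrywise topology of matrices;
it is bounded for the maximum norm, each entry being at most 1. *)
Lemma rayleigh_min (R : realType) (H : innerProductType R) (m : nat)
    (v : 'I_m.+1 -> H) :
  exists2 xi : 'cV[R]_m.+1, inner xi xi = 1 &
    forall eta, inner (cols v xi) (cols v xi) * inner eta eta
      <= inner (cols v eta) (cols v eta).
Proof.
pose S : set 'rV[R]_m.+1 := [set r | inner r^T r^T = 1].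
pose q (r : 'rV[R]_m.+1) := inner (cols v r^T) (cols v r^T).
have coordM i j : continuous (fun r : 'rV[R]_m.+1 => r 0 i * r 0 j).
  by move=> r; apply: (@continuousM R 'rV[R]_m.+1); exact: coord_continuous.
have cinner : continuous (fun r : 'rV[R]_m.+1 => inner r^T r^T).
  have -> : (fun r : 'rV[R]_m.+1 => inner r^T r^T) =
            (fun r => \sum_(i < m.+1) r 0 i * r 0 i).
    by apply/funext => r; apply: eq_bigr => i _; rewrite !mxE.
  by apply: continuous_big => [|i _]; [exact: add_continuous|exact: coordM].
have cq : continuous q.
  have -> : q = (fun r => \sum_(i < m.+1) \sum_(j < m.+1)
      r 0 i * r 0 j * inner (v j) (v i)).
    apply/funext => r; rewrite /q inner_suml; apply: eq_bigr => i _.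
    rewrite innerZl innerC inner_suml mulr_sumr; apply: eq_bigr => j _.
    by rewrite innerZl !mxE mulrA.
  apply: continuous_big => [|i _]; first exact: add_continuous.
  apply: continuous_big => [|j _ r]; first exact: add_continuous.
  apply: (@continuousM R 'rV[R]_m.+1); [exact: coordM|exact: cst_continuous].
have S0 : S !=set0.
  exists (delta_mx 0 0); rewrite /S /= trmx_delta.
  rewrite [LHS](bigD1 0)//= big1 => [|i i0]; rewrite !mxE ?eqxx ?mulr1 ?addr0//.
  by rewrite (negbTE i0) mulr0.
have Sbounded : bounded_set S.
  exists 1; split; rewrite ?num_real// => M M1 r /= Sr.
  apply: (le_trans _ (ltW M1)).
  rewrite -[`|r|]/(mx_norm r) mx_normrE; apply: bigmax_le => // -[i j] _ /=.
  rewrite ord1 -(@ler_pXn2r _ 2)// ?nnegrE// expr1n real_normK ?num_real// -Sr.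
  rewrite [leRHS](bigD1 j)//= !mxE -expr2 lerDl.
  by apply: sumr_ge0 => k _; rewrite -expr2 sqr_ge0.
have Sclosed : closed S.
  apply: (@closed_comp _ _ (fun r : 'rV[R]_m.+1 => inner r^T r^T) [set 1]).
    by move=> r _; exact: cinner.
  exact: closed_eq.
have [r] := EVT_min_rV S0 (bounded_closed_compact Sbounded Sclosed)
  (continuous_subspaceT cq).
rewrite inE => Sr rmin; exists r^T => // eta.
have [->|eta0] := eqVneq eta 0.
  by rewrite (linear0 (cols v)) !inner0l mulr0.
have eta_gt0 := inner_gt0 eta0.
(* the Rayleigh quotient is homogeneous of degree 0: normalise eta *)
pose t := (Num.sqrt (inner eta eta))^-1.
have t2 : t * (t * inner eta eta) = 1.
  by rewrite mulrA -expr2 exprVn sqr_sqrtr ?(ltW eta_gt0)// mulVf// gt_eqF.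
have := rmin (t *: eta)^T; rewrite inE /S /q /= trmxK innerZl innerZr t2.
move=> /(_ erefl); rewrite linearZ/= innerZl innerZr mulrA -expr2.
rewrite -ler_pdivrMl ?exprn_gt0 ?invr_gt0 ?sqrtr_gt0//.
by rewrite mulrC exprVn invrK sqr_sqrtr// ltW.
Qed.

(** First-order condition at the minimizer xi: the form
|cols v eta|^2 - c |eta|^2 is nonnegative and vanishes at xi, so its expansion
along xi + t eta has no term of order 1 in t. The first clause says, in weak
form, that xi is an eigenvector of the Gram matrix for the eigenvalue c. *)
Lemma min_eigen (R : realType) (H : innerProductType R) (m : nat)
    (v : 'I_m.+1 -> H) :
  exists2 xi : 'cV[R]_m.+1, inner xi xi = 1 &
    let c := inner (cols v xi) (cols v xi) in
    (forall eta, inner (cols v eta) (cols v xi) = c * inner eta xi) /\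
    (forall eta, c * inner eta eta <= inner (cols v eta) (cols v eta)).
Proof.
have [xi xi1 ximin] := rayleigh_min v; exists xi => // c; split => // eta.
apply/subr0_eq.
apply: (@nonneg_quadratic_linear_term _ _
  (inner (cols v eta) (cols v eta) - c * inner eta eta)).
  by rewrite subr_ge0.
move=> t; have := ximin (xi + t *: eta).
rewrite -subr_ge0 linearD linearZ_LR !(innerDl, innerDr, innerZl, innerZr).
rewrite (innerC xi eta) (innerC (cols v xi) (cols v eta)) -/c xi1.
by congr (0 <= _); ring.
Qed.

(** The least Rayleigh quotient c of [cols z] is positive by injectivity and
sqrt c is a singular value of A, with singular vector [cols u xi]; minimality
of mu gives mu^2 <= c. *)
Lemma smallest_singular_value_le (R : realType) (E F : innerProductType R)
    (p : nat) (u : 'I_p -> E) (z : 'I_p -> F) (A : E -> F) (mu : R) :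
  orthonormal_family u -> (forall e, A e = cols z (adjoint (cols u) e)) ->
  set_inj (spanned u) A -> smallest_singular_value A mu ->
  forall e, spanned u e -> mu ^+ 2 * inner e e <= inner (A e) (A e).
Proof.
move=> ou AE Ainj [[mu_gt0 _] mu_le].
case: p u z ou AE Ainj => [|p] u z ou AE Ainj _ [eta _ <-].
  by rewrite /cols big_ord0 inner0l mulr0 inner_ge0.
have AuE xi : A (cols u xi) = cols z xi by rewrite AE adjoint_cols_orthonormal.
have [xi xi1 [xiE ximin]] := min_eigen z.
set c := inner (cols z xi) _ in xiE ximin.
have uxi0 : cols u xi != 0.
  apply: contra_eq_neq xi1 => uxi0.
  have -> : xi = 0.
    rewrite -(adjoint_cols_orthonormal xi ou) uxi0 adjoint_cols.
    by apply/colP => k; rewrite !mxE innerC inner0l.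
  by rewrite inner0l eq_sym oner_eq0.
have c_gt0 : 0 < c.
  apply: inner_gt0; apply: contra_neq uxi0 => zxi0.
  apply: Ainj; rewrite ?inE; [exact: spanned_cols| |].
    by rewrite -(linear0 (cols u)); exact: spanned_cols.
  by rewrite AuE zxi0 -(linear0 (cols u)) AuE linear0.
have mu2c : mu ^+ 2 <= c.
  rewrite -[leRHS]sqr_sqrtr ?(ltW c_gt0)// ler_pXn2r// ?nnegrE ?sqrtr_ge0 ?(ltW mu_gt0)//.
  apply: mu_le; split; first by rewrite sqrtr_gt0.
  exists (cols u xi) => //; apply: adjoint_eq => e.
  rewrite AuE AE xiE sqr_sqrtr ?(ltW c_gt0)// innerZr.
  by rewrite (innerC e) adjoint_colsP innerC.
rewrite AuE adjoint_colsP adjoint_cols_orthonormal//.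
by apply: le_trans (ximin eta); rewrite ler_wpM2r// inner_ge0.
Qed.

(** * Method III as a least-squares problem *)

(** By Pythagoras, |A v - b|^2 = |A v - A w|^2 + |A w - b|^2 on S, so a minimizer
v has A v = A w. *)
Lemma least_squares_argmin (R : realType) (T : Type) (F : hilbertType R)
    (A : T -> F) (b : F) (S : set T) (w : T) :
  S w -> set_inj S A ->
  (forall v, S v -> inner (A v - A w) (A w - b) = 0) ->
  argmin (fun v => `|A v - b|) S = [set w].
Proof.
move=> Sw Ainj ow.
have sqrE v : S v -> `|A v - b| ^+ 2 = `|A v - A w| ^+ 2 + `|A w - b| ^+ 2.
  by move=> Sv; rewrite !sqr_normE -pythagoras ?ow// addrA subrK.
apply/seteqP; split => [v [Sv /(_ w Sw)]|_ ->].
  rewrite -(@ler_pXn2r _ 2)// ?nnegrE// sqrE// gerDr => le0.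
  apply: Ainj; rewrite ?inE//; apply/subr0_eq/eqP.
  by rewrite -normr_eq0 -sqrf_eq0 eq_le le0 sqr_ge0.
split=> // v Sv; rewrite -(@ler_pXn2r _ 2)// ?nnegrE// (sqrE v)//.
by rewrite lerDr sqr_ge0.
Qed.

Lemma argmin1 (R : realType) (T : Type) (f : T -> R) (w : T) :
  argmin f [set w] = [set w].
Proof.
by apply/seteqP; split => [v []|_ ->]//; split => // _ ->.
Qed.

Lemma Zn_cols (R : realType) (Y : lmodType R) (n p : nat) (y : nat -> Y)
    (lam : 'rV[R]_p) (Xi : 'M[R]_(n, p)) (xi : 'cV[R]_p) :
  Zn y lam Xi xi = cols (fun k => Zn y lam Xi (delta_mx k 0)) xi.
Proof.
have {1}-> : xi = \sum_k xi k 0 *: delta_mx k 0.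
  by rewrite {1}[xi]matrix_sum_delta; apply: eq_bigr => k _; rewrite big_ord1.
rewrite /Zn !mulmx_sumr linear_sum; apply: eq_bigr => k _.
by rewrite -!scalemxAr linearZ.
Qed.

Lemma Kn_spanned (R : realType) (X : innerProductType R) (Y : lmodType R) (n p : nat)
    (y : nat -> Y) (u : 'I_p -> X) (lam : 'rV[R]_p) (Xi : 'M[R]_(n, p)) v :
  spanned (@centered R Y n y) (Kn y u lam Xi v).
Proof. exact: spanned_cols. Qed.

Lemma KnD (R : realType) (X : innerProductType R) (Y : lmodType R) (n p : nat)
    (y : nat -> Y) (u : 'I_p -> X) (lam : 'rV[R]_p) (Xi : 'M[R]_(n, p)) a b :
  Kn y u lam Xi (a + b) = Kn y u lam Xi a + Kn y u lam Xi b.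
Proof. by rewrite /Kn adjoint_colsD !Zn_cols linearD. Qed.

(** The adjoint of [cols u] kills the orthogonal complement of the span of u. *)
Lemma Kn_orth_proj (R : realType) (X : innerProductType R) (Y : lmodType R) (n p : nat)
    (y : nat -> Y) (u : 'I_p -> X) (lam : 'rV[R]_p) (Xi : 'M[R]_(n, p)) v :
  Kn y u lam Xi (orth_proj (spanned u) v) = Kn y u lam Xi v.
Proof.
rewrite -[in RHS](subrK (orth_proj (spanned u) v) v) KnD.
rewrite -[LHS]add0r; congr (_ + _).
have -> : 0 = Zn y lam Xi 0 by rewrite Zn_cols linear0.
congr (Zn _ _ _ _); rewrite adjoint_cols; apply/colP => k; rewrite !mxE innerC.
apply/esym/(orth_projP u v).2.
exists (delta_mx k 0) => //; rewrite /cols (bigD1 k)//= big1 => [|i ik].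
  by rewrite !mxE !eqxx scale1r addr0.
by rewrite !mxE (negbTE ik) scale0r.
Qed.

(** The projector onto Y_n fixes the range of K_n, and replacing the data by
their projection changes the residual by a vector orthogonal to that range. So
the solution w of the unprojected normal equations is the unique minimizer, and
then trivially the one of least E_n-norm. *)
Lemma methodIII_normal_equations (R : realType) (X Y : hilbertType R)
    (n p : nat) (y : nat -> Y) (u : 'I_p -> X) (lam : 'rV[R]_p)
    (Xi : 'M[R]_(n, p)) (x : nat -> X) (b : Y) :
  let A := Kn y u lam Xi in
  orthonormal_family u -> set_inj (spanned u) A ->
  exists2 w, spanned u w &
    methodIII x y u lam Xi b = sample_mean n x + w /\
    forall v, spanned u v -> inner (A w - (b - sample_mean n y)) (A v) = 0.
Proof.
move=> A ou Ainj.
pose z k := Zn y lam Xi (delta_mx k 0).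
have AuE xi : A (cols u xi) = cols z xi.
  by rewrite /A /Kn adjoint_cols_orthonormal// Zn_cols.
set c := b - sample_mean n y.
have [xi xiP] := normal_equations z c.
have oxi v : spanned u v -> inner (A (cols u xi) - c) (A v) = 0.
  by move=> [eta _ <-]; rewrite !AuE -opprB -scaleN1r innerZl xiP mulr0.
exists (cols u xi); first exact: spanned_cols.
split => //; rewrite /methodIII; congr (_ + _).
have PA v : orth_proj (spanned (@centered R Y n y)) (A v) = A v.
  exact/orth_proj_id/Kn_spanned.
rewrite (@least_squares_argmin _ _ _ _ _ _ (cols u xi)).
- by rewrite argmin1; apply: xget_unique.
- exact: spanned_cols.
- by move=> v v' sv sv'; rewrite !PA; exact: Ainj.
move=> v sv; rewrite !PA innerC innerBr.
have o v' : spanned u v' -> inner (A (cols u xi) -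
    orth_proj (spanned (@centered R Y n y)) c) (A v') = 0.
  move=> sv'.
  rewrite -[A (cols u xi)](subrK c) -addrA innerDl oxi// add0r.
  exact/(orth_projP _ c).2/Kn_spanned.
by rewrite !o// ?subrr//; exact: spanned_cols.
Qed.

(** * The error estimate *)

Theorem proposition4p2 (R : realType) (X Y : hilbertType R)
    (K : {linear X -> Y}) (K_bounded : bounded_near K (nbhs (0 : X)))
    (K_range : ~ closed (range K))
    (x : nat -> X) (y : nat -> Y) (delta : R) (delta_gt0 : 0 < delta)
    (noise : forall k, `|y k - K (x k)| <= delta)
    (n p : nat) (p_gt0 : (0 < p)%N)
    (u : 'I_p -> X) (lam : 'rV[R]_p) (Xi : 'M[R]_(n, p))
    (svd : is_svd (cols (@centered R X n x)) u lam Xi)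
    (xdag : X)
    (Kn_inj : set_inj (spanned u) (Kn y u lam Xi))
    (mu : R) (mu_min : smallest_singular_value (Kn y u lam Xi) mu) :
  let xo := sample_mean n x in
  let yo := sample_mean n y in
  exists d : X,
    methodIII x y u lam Xi (K xdag) - xdag
      = ((xo - xdag) - orth_proj (spanned u) (xo - xdag)) + d
    /\ `|d| <= mu^-1 * (`|K (xo - xdag) - Kn y u lam Xi (xo - xdag)|
                        + `|yo - K xo|).
Proof.
move=> xo yo; have [ou _ _ _] := svd.
have mu_gt0 := mu_min.1.1.
have [w sw [-> ow]] := methodIII_normal_equations x (K xdag) ou Kn_inj.
set A := Kn y u lam Xi in Kn_inj mu_min ow *.
set e := xo - xdag.
have [sP _] := orth_projP u e.
set d := w + orth_proj (spanned u) e.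
have sd : spanned u d by exact: spannedD.
exists d; split.
  by rewrite /d [w + _]addrC addrA subrK /e addrAC.
set r := (K xdag - yo) + A e.
have rE : r = - (K e - A e) - (yo - K xo).
  by rewrite /r addrC /e (linearB K) !opprB -[RHS]addrA (addrA (_ - _)) subrK.
have Ad : A d = A w + A e by rewrite /A /d KnD Kn_orth_proj.
(* the normal equations make A d the projection of r onto the range of A *)
have ord : inner (r - A d) (A d) = 0.
  have -> : r - A d = -1 *: (A w - (K xdag - yo)).
    by rewrite scaleN1r Ad /r opprB opprD addrACA subrr addr0.
  by rewrite innerZl ow// mulr0.
rewrite ler_pdivlMl//.
have mud : mu * `|d| <= `|A d|.
  rewrite -(@ler_pXn2r _ 2)// ?nnegrE ?mulr_ge0 ?(ltW mu_gt0)//.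
  rewrite exprMn !sqr_normE.
  apply: (smallest_singular_value_le ou _ Kn_inj mu_min sd) => v.
  exact: Zn_cols.
apply: (le_trans mud); apply: (@le_trans _ _ `|r|).
  rewrite -(@ler_pXn2r _ 2)// ?nnegrE// !sqr_normE.
  by rewrite -[r in leRHS](subrK (A d)) (pythagoras ord) lerDr inner_ge0.
by rewrite rE (le_trans (ler_normB _ _))// normrN.
Qed.
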